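(* Let $w$, $w_{\pm\frac12}$, the inner product on the parabola $\Omega=\{(x,x^2):x\in\mathbb R\}$, and the basis $Y_{n,1}(x,y)=p_n(w_{-\frac12};y)$, $Y_{n,2}(x,y)=x\,p_{n-1}(w_{\frac12};y)$ be as in the context. Let $f\in L^2(\varpi,\Omega)$ and define for $y>0$ $$f_e(y)=\frac{f(\sqrt y,y)+f(-\sqrt y,y)}{2},\qquad f_o(y)=\frac{f(\sqrt y,y)-f(-\sqrt y,y)}{2\sqrt y}.$$ Then for all $(x,y)\in\Omega$ and $n\ge1$, $$S_nf(x,y)=s_n(w_{-\frac12};f_e,y)+x\,s_{n-1}(w_{\frac12};f_o,y).$$ In particular, if $s_n(w_{-\frac12};f_e,y)\to f_e(y)$ and $s_{n-1}(w_{\frac12};f_o,y)\to f_o(y)$ at $y=x^2>0$, then $S_nf(x,y)\to f(x,y)$. Furthermore $$\|f-S_nf\|^2_{L^2(\varpi,\Omega)}=\|s_n(w_{-\frac12};f_e)-f_e\|^2_{L^2(w_{-\frac12})}+\|s_{n-1}(w_{\frac12};f_o)-f_o\|^2_{L^2(w_{\frac12})}.$$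
   Context: $w$ is a nonnegative weight on $[0,\infty)$, $w_{-\frac12}(t)=t^{-\frac12}w(t)$, $w_{\frac12}(t)=t^{\frac12}w(t)$. The inner product is $\langle f,g\rangle=\int_{\mathbb R}f(x,x^2)g(x,x^2)w(x^2)\,dx$, with $\|f\|^2_{L^2(\varpi,\Omega)}=\langle f,f\rangle$. For a weight $v$: $p_n(v;\cdot)$ is an orthogonal polynomial of degree $n$ for $v$, $h_n(v)=\int p_n(v)^2v$, $\widehat g_k(v)=h_k(v)^{-1}\int g\,p_k(v)\,v$, $s_n(v;g,x)=\sum_{k=0}^n\widehat g_k(v)p_k(v;x)$, and $L^2(v)$ is the weighted $L^2$ space. For $f\in L^2(\varpi,\Omega)$, $S_nf=\widehat f_0+\sum_{k=1}^n[\widehat f_{k,1}Y_{k,1}+\widehat f_{k,2}Y_{k,2}]$ with $\widehat f_0=\langle f,1\rangle/\langle 1,1\rangle$, $\widehat f_{k,i}=\langle f,Y_{k,i}\rangle/\langle Y_{k,i},Y_{k,i}\rangle$. *)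

(* Defs.v *)
From HB Require Import structures.
From mathcomp Require Import all_boot all_order all_algebra.
From mathcomp Require Import all_classical all_reals all_analysis.
Set Implicit Arguments.
Unset Strict Implicit.
Unset Printing Implicit Defensive.
Import Order.TTheory GRing.Theory Num.Theory.
Import numFieldNormedType.Exports.

Local Open Scope classical_set_scope.
Local Open Scope ring_scope.

Section Defs.
Variable R : realType.
Local Notation mu := (@lebesgue_measure R).

Definition halfline : set R := `[0, +oo[%classic.

Definition wm (w : R -> R) (t : R) : R := (Num.sqrt t)^-1 * w t.
Definition wp (w : R -> R) (t : R) : R := Num.sqrt t * w t.

Definition vpair (v g h : R -> R) : R :=
  \int[mu]_(t in halfline) (g t * h t * v t).

Definition vnorm2 (v g : R -> R) : R := \int[mu]_(t in halfline) (g t ^+ 2 * v t).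

Definition inL2v (v g : R -> R) : Prop :=
  measurable_fun halfline g /\
  mu.-integrable halfline (fun t => (g t ^+ 2 * v t)%:E).

Definition OPS (v : R -> R) (p : nat -> {poly R}) : Prop :=
  [/\ forall n, size (p n) = n.+1,
      forall n m, mu.-integrable halfline
                    (fun t => ((p n).[t] * (p m).[t] * v t)%:E),
      forall n m, n <> m -> vpair v (fun t => (p n).[t]) (fun t => (p m).[t]) = 0
    & forall n, 0 < vpair v (fun t => (p n).[t]) (fun t => (p n).[t])].

Definition hk (v : R -> R) (p : nat -> {poly R}) (k : nat) : R :=
  vpair v (fun t => (p k).[t]) (fun t => (p k).[t]).
Definition ghat (v : R -> R) (p : nat -> {poly R}) (g : R -> R) (k : nat) : R :=
  (hk v p k)^-1 * vpair v g (fun t => (p k).[t]).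
Definition spart (v : R -> R) (p : nat -> {poly R}) (g : R -> R) (n : nat) (y : R) : R :=
  \sum_(k < n.+1) ghat v p g k * (p k).[y].

(** functions on the parabola Omega = {(x, x^2)} are functions R*R -> R,
    inner product <f,g> = int_R f(x,x^2) g(x,x^2) w(x^2) dx *)
Definition pip (w : R -> R) (f g : R * R -> R) : R :=
  \int[mu]_(x in [set: R]) (f (x, x ^+ 2) * g (x, x ^+ 2) * w (x ^+ 2)).

Definition inL2par (w : R -> R) (f : R * R -> R) : Prop :=
  measurable_fun [set: R] (fun x => f (x, x ^+ 2)) /\
  mu.-integrable [set: R] (fun x => (f (x, x ^+ 2) ^+ 2 * w (x ^+ 2))%:E).

Definition Y1 (p1 : nat -> {poly R}) (n : nat) (z : R * R) : R := (p1 n).[z.2].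
Definition Y2 (p2 : nat -> {poly R}) (n : nat) (z : R * R) : R := z.1 * (p2 n.-1).[z.2].

Definition Sn (w : R -> R) (p1 p2 : nat -> {poly R}) (f : R * R -> R) (n : nat)
    (z : R * R) : R :=
  pip w f (fun _ => 1) / pip w (fun _ => 1) (fun _ => 1) +
  \sum_(1 <= k < n.+1)
     (pip w f (Y1 p1 k) / pip w (Y1 p1 k) (Y1 p1 k) * Y1 p1 k z +
      pip w f (Y2 p2 k) / pip w (Y2 p2 k) (Y2 p2 k) * Y2 p2 k z).

Definition fe (f : R * R -> R) (y : R) : R :=
  (f (Num.sqrt y, y) + f (- Num.sqrt y, y)) / 2.
Definition fo (f : R * R -> R) (y : R) : R :=
  (f (Num.sqrt y, y) - f (- Num.sqrt y, y)) / (2 * Num.sqrt y).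

End Defs.

(* Main.v *)
Require Import Defs.
From HB Require Import structures.
From mathcomp Require Import all_boot all_order all_algebra.
From mathcomp Require Import all_classical all_reals all_analysis.
From mathcomp Require Import measurable_realfun ring lra.
Set Implicit Arguments.
Unset Strict Implicit.
Unset Printing Implicit Defensive.
Import Order.TTheory GRing.Theory Num.Theory.
Import numFieldNormedType.Exports.
Local Open Scope classical_set_scope.
Local Open Scope ring_scope.

(** Substituting [t = x ^+ 2] on each half of the parabola turns the integral of
    [F] over the line into the integral over the half-line of
    [(F (sqrt t) + F (- sqrt t)) / (2 sqrt t)].  For [F = f g w] the cross terms
    between even and odd parts cancel, so
    [<f, g> = <fe f, fe g>_(wm w) + <fo f, fo g>_(wp w)].
    Since [Y1] is even and [Y2] is [x] times an even function, the first summand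
    alone sees [Y1] and the second alone sees [Y2]: this identifies the Fourier
    coefficients, and applied to [f - Sn f] it gives the norm identity.
    As the functions are only measurable, the substitution is obtained from
    uniqueness of Lebesgue measure: the image of [2 |x| dx] under [x |-> x |x|]
    gives every interval its length. *)

Import HBNNSimple.

(** * Change of variables for a density whose image is Lebesgue measure *)

(** The image under [phi] of the measure with density [g] is determined by its values on half-open
    intervals, so it is Lebesgue measure. The formula then holds for indicators, for simple
    functions by linearity, and for [H] by monotone convergence. *)
Lemma ge0_integral_pushforward_density d (T : measurableType d) (R : realType)
    (mu : {measure set T -> \bar R}) (g : T -> R)
    (phi : T -> measurableTypeR R) (H : R -> \bar R) :
  measurable_fun [set: T] g -> (forall x, 0 <= g x) ->
  measurable_fun [set: T] phi ->
  (forall X : set (measurableTypeR R), ocitv X ->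
    @lebesgue_measure R X = \int[mu]_(x in phi @^-1` X) (g x)%:E)%E ->
  measurable_fun [set: R] H -> (forall y, 0 <= H y)%E ->
  (\int[@lebesgue_measure R]_y H y = \int[mu]_x (H (phi x) * (g x)%:E))%E.
Proof.
move=> mg g0 mphi ocE mH H0.
have mpre A : measurable A -> measurable (phi @^-1` A).
  by move=> mA; rewrite -[X in measurable X]setTI; exact: mphi.
pose nu (A : set (measurableTypeR R)) := (\int[mu]_(x in phi @^-1` A) (g x)%:E)%E.
have nu0 : nu set0 = 0%E by rewrite /nu preimage_set0 integral_set0.
have nu_ge0 A : (0 <= nu A)%E by apply: integral_ge0 => x _; rewrite lee_fin.
have nu_sigma : semi_sigma_additive nu.
  move=> F mF tF mUF; rewrite /nu preimage_bigcup.
  have mPF i : measurable (phi @^-1` F i) by exact: mpre.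
  have tPF : trivIset setT (fun i => phi @^-1` F i).
    apply/trivIsetP => i j _ _ ij; rewrite -preimage_setI.
    by move/trivIsetP : tF => ->//; rewrite preimage_set0.
  rewrite ge0_integral_bigcup//; last first.
  - by move=> x _; rewrite lee_fin.
  - by apply/measurable_EFinP/measurable_funTS.
  by apply: is_cvg_ereal_nneg_natsum => n _; exact: nu_ge0.
pose nuM : {measure set (measurableTypeR R) -> \bar R} :=
  HB.pack nu (isMeasure.Build _ _ _ nu nu0 nu_ge0 nu_sigma).
have nuE A : measurable A -> @lebesgue_measure R A = nu A.
  exact: (@lebesgue_measure_unique R nuM).
pose h := nnsfun_approx (@measurableT _ R) mH.
have hcvg y : EFin \o h ^~ y @ \oo --> H y by exact: cvg_nnsfun_approx.
have hmono y m n : (m <= n)%N -> ((h m y)%:E <= (h n y)%:E)%E.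
  by move=> mn; rewrite lee_fin; have /lefP := nd_nnsfun_approx measurableT mH mn; exact.
have hpos n y : (0 <= (h n y)%:E)%E by rewrite lee_fin.
have mhphi n : measurable_fun [set: T] (fun x => h n (phi x)).
  exact: (measurableT_comp (measurable_funPT (h n)) mphi).
(* Both sides are limits along the same increasing simple functions [h n], so it is enough to treat
   one [h n]. *)
transitivity (limn (fun n => \int[@lebesgue_measure R]_y (h n y)%:E))%E.
  rewrite -monotone_convergence//.
  - by apply: eq_integral => y _; apply/esym/cvg_lim => //; exact: hcvg.
  - by move=> n; apply/measurable_EFinP; exact: (measurable_funPT (h n)).
  - by move=> y _ m n mn; exact: hmono.
transitivity (limn (fun n => \int[mu]_x ((h n (phi x))%:E * (g x)%:E)))%E; last first.
  rewrite -monotone_convergence//.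
  - apply: eq_integral => x _; apply/cvg_lim => //.
    by apply: cvgeZr => //; exact: hcvg.
  - by move=> n; under eq_fun do rewrite -EFinM; apply/measurable_EFinP; exact: measurable_funM.
  - by move=> n x _; rewrite mule_ge0 // lee_fin.
  - move=> x _ m n mn; rewrite lee_wpmul2r ?lee_fin//.
    by rewrite -lee_fin; exact: hmono.
congr (limn _); apply/funext => n.
have mhn r : measurable (h n @^-1` [set r]) by exact: measurable_sfunP.
have mind r : measurable_fun [set: measurableTypeR R]
    (\1_(h n @^-1` [set r]) : measurableTypeR R -> R).
  by apply: (@measurable_indic _ (measurableTypeR R)); exact: mhn.
have mindphi r : measurable_fun [set: T] (fun x => \1_(h n @^-1` [set r]) (phi x) : R).
  exact: (measurableT_comp (mind r) mphi).
(* Each [h n] is a finite sum over its level sets, which leaves a single indicator on each side. *)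
transitivity (\sum_(r \in range (h n))
    \int[@lebesgue_measure R]_y (r * \1_(h n @^-1` [set r]) y)%:E)%E.
  under eq_integral do rewrite fimfunE -fsumEFin//.
  rewrite ge0_integral_fsum//.
  - by move=> r; apply/measurable_EFinP; apply: measurable_funM => //; exact: mind.
  - by move=> r x _; rewrite nnfun_muleindic_ge0.
transitivity (\sum_(r \in range (h n))
    \int[mu]_x ((r * \1_(h n @^-1` [set r]) (phi x))%:E * (g x)%:E))%E; last first.
  rewrite -ge0_integral_fsum//.
  - apply: eq_integral => x _; rewrite fimfunE -fsumEFin// ge0_mule_fsuml//.
    by move=> r; rewrite nnfun_muleindic_ge0.
  - move=> r; under eq_fun do rewrite -EFinM; apply/measurable_EFinP.
    by apply: measurable_funM => //; apply: measurable_funM => //; exact: mindphi.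
  - by move=> r x _; rewrite mule_ge0 ?lee_fin// -lee_fin nnfun_muleindic_ge0.
apply: eq_fsbigr => r; rewrite inE => -[y _ <-].
under [LHS]eq_integral do rewrite EFinM.
rewrite ge0_integralZl//; last first.
  by apply/measurable_EFinP; exact: mind.
rewrite integral_indic//; last exact: mhn.
(* On one level set the claim is exactly the equality of [nu] with Lebesgue measure. *)
rewrite setIT; transitivity ((h n y)%:E * nu (h n @^-1` [set h n y]))%E.
  by congr (_ * _)%E; apply: nuE; exact: mhn.
under [RHS]eq_integral do rewrite EFinM -muleA.
rewrite ge0_integralZl//; last 2 first.
- under eq_fun do rewrite -EFinM; apply/measurable_EFinP.
  by apply: measurable_funM => //; exact: mindphi.
- by move=> x _; rewrite mule_ge0 ?lee_fin.
congr (_ * _)%E; rewrite /nu integral_mkcond.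
apply: eq_integral => x _; rewrite patchE indicE.
have -> : (phi x \in h n @^-1` [set h n y]) = (x \in phi @^-1` (h n @^-1` [set h n y])).
  by apply/idP/idP; rewrite !inE.
by case: ifP => _; rewrite ?mul1e ?mul0e.
Qed.

(** * The signed square x |x|, its inverse, and the substitution it gives *)

Section signed_square.
Context {R : realType}.

(* [y * `|y|] differs from its linear part at [x] by at most [(y - x) ^+ 2], so the
   kink at [0] needs no separate treatment. *)
Lemma is_derive_mulr_norm (x : R) : is_derive x 1 (fun y => y * `|y|) (2 * `|x|).
Proof.
have key (h : R) : `|(h + x) * `|h + x| - x * `|x| - 2 * `|x| * h| <= h ^+ 2.
  rewrite ler_norml.
  by have [?|?] := ger0P (h + x); have [?|?] := ger0P x; apply/andP; split; nra.
have cv : h^-1 *: (((fun y : R => y * `|y|) \o shift x) (h *: 1) - x * `|x|)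
    @[h --> 0^'] --> 2 * `|x|.
  apply/cvgrPdist_le => e e0; near=> h.
  have h0 : h != 0 by near: h; exact: nbhs_dnbhs_neq.
  rewrite /= distrC.
  have -> : h^-1 *: ((h *: 1 + x) * `|h *: 1 + x| - x * `|x|) - 2 * `|x| =
     h^-1 * ((h + x) * `|h + x| - x * `|x| - 2 * `|x| * h).
    by rewrite /GRing.scale /= mulr1; field.
  (* After multiplying out, the quadratic bound [key] leaves only |h| <= e to check. *)
  rewrite normrM normfV mulrC ler_pdivrMr ?normr_gt0//.
  apply: (le_trans (key h)); rewrite -real_normK ?num_real// expr2.
  rewrite ler_wpM2r//.
  near: h; apply: dnbhs0_le; exact: e0.
apply: DeriveDef; first by apply/cvg_ex; exists (2 * `|x|).
exact/cvg_lim.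
Unshelve. all: by end_near.
Qed.

(** Fundamental theorem of calculus for the antiderivative x |x|. *)
Lemma integral_norm (a b : R) : a <= b ->
  (\int[@lebesgue_measure R]_(x in `]a, b]) (2 * `|x|)%:E = (b * `|b| - a * `|a|)%:E)%E.
Proof.
rewrite le_eqVlt => /predU1P[->|ab].
  by rewrite set_itv_ge ?bnd_simp ?ltxx// integral_set0 subrr.
have cg : continuous (fun x : R => 2 * `|x|).
  by move=> x; apply: cvgM; [exact: cvg_cst|exact: cvg_norm].
rewrite integral_itv_obnd_cbnd; last first.
  have mg : measurable_fun [set: R] (fun x : R => 2 * `|x|).
    exact: continuous_measurable_fun.
  by apply/measurable_EFinP; exact: measurable_funTS mg.
have cF : continuous (fun x : R => x * `|x|).
  move=> x; apply: cvgM; [exact: cvg_id|exact: cvg_norm].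
rewrite (@continuous_FTC2 _ _ (fun x => x * `|x|))//.
- exact: continuous_subspaceT.
- split.
  + by move=> x _; have [] := is_derive_mulr_norm x.
  + exact/cvg_at_right_filter/cF.
  + exact/cvg_at_left_filter/cF.
- by move=> x _; rewrite derive1E; exact: (@derive_val _ _ _ _ _ _ _ (is_derive_mulr_norm x)).
Qed.

(* The inverse of [x |-> x * `|x|], since [Num.sqrt] is [0] on negative numbers. *)
Definition signed_sqrt (y : R) : R := Num.sqrt y - Num.sqrt (- y).

Lemma signed_sqrtK : cancel signed_sqrt (fun x => x * `|x|).
Proof.
move=> y; rewrite /signed_sqrt; have [y0|y0] := leP 0 y.
  rewrite (@ler0_sqrtr _ (- y)) ?oppr_le0// subr0 ger0_norm ?sqrtr_ge0//.
  by rewrite -expr2 sqr_sqrtr.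
rewrite (@ler0_sqrtr _ y) ?ltW// sub0r normrN ger0_norm ?sqrtr_ge0//.
by rewrite mulNr -expr2 sqr_sqrtr ?opprK// oppr_ge0 ltW.
Qed.

Lemma mulr_normK : cancel (fun x : R => x * `|x|) signed_sqrt.
Proof.
move=> x; rewrite /signed_sqrt; have [x0|x0] := ger0P x.
  rewrite -expr2 sqrtr_sqr ger0_norm// ler0_sqrtr ?subr0//.
  by rewrite oppr_le0 sqr_ge0.
rewrite mulrN opprK -expr2 (@ler0_sqrtr _ (- _)) ?oppr_le0 ?sqr_ge0//.
by rewrite sqrtr_sqr ltr0_norm// sub0r opprK.
Qed.

Lemma ltr_mulr_norm : {mono (fun x : R => x * `|x|) : x y / x < y}.
Proof.
apply: leW_mono; apply: le_mono => x y /=.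
by have [?|?] := ger0P x; have [?|?] := ger0P y => ?; nra.
Qed.

Lemma lt_signed_sqrt (y x : R) : (signed_sqrt y < x) = (y < x * `|x|).
Proof. by rewrite -[X in X < x * _](signed_sqrtK y) (ltr_mulr_norm (signed_sqrt y)). Qed.

Lemma le_signed_sqrt (y x : R) : (x <= signed_sqrt y) = (x * `|x| <= y).
Proof. by rewrite !leNgt lt_signed_sqrt. Qed.

Lemma preimage_mulr_norm (a b : R) :
  (fun x => x * `|x|) @^-1` `]a, b] = `]signed_sqrt a, signed_sqrt b]%classic.
Proof.
by apply/seteqP; split => x /=; rewrite !in_itv/= lt_signed_sqrt le_signed_sqrt.
Qed.

Lemma measurable_sqrt (D : set R) : measurable_fun D (@Num.sqrt R).
Proof.
have ms : measurable_fun [set: R] (@Num.sqrt R).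
  by apply: continuous_measurable_fun; exact: sqrt_continuous.
exact: measurable_funTS ms.
Qed.

Lemma measurable_mulr_norm :
  measurable_fun [set: R] (fun x => x * `|x| : measurableTypeR R).
Proof. by apply: measurable_funM => //; exact: measurableT_comp. Qed.

(** The preimage of an interval from a to b is the interval between their signed square roots, over
    which 2 |x| integrates to b - a. *)
Lemma ge0_integral_mulr_norm (H : R -> \bar R) :
  measurable_fun [set: R] H -> (forall y, 0 <= H y)%E ->
  (\int[@lebesgue_measure R]_y H y =
   \int[@lebesgue_measure R]_x (H (x * `|x|)%R * (2 * `|x|)%:E))%E.
Proof.
move=> mH H0.
apply: (@ge0_integral_pushforward_density _ (measurableTypeR R) R (@lebesgue_measure R)
  (fun x => 2 * `|x|) (fun x => x * `|x|) H) => //.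
- by apply: measurable_funM => //; exact: measurableT_comp.
- exact: measurable_mulr_norm.
move=> _ [[a b] _ <-] /=; rewrite preimage_mulr_norm lebesgue_measure_itv/=.
rewrite lte_fin; case: ltP => ab.
  rewrite integral_norm ?signed_sqrtK//.
  by rewrite le_signed_sqrt signed_sqrtK ltW.
rewrite set_itv_ge ?integral_set0// bnd_simp -leNgt.
by rewrite le_signed_sqrt signed_sqrtK.
Qed.

End signed_square.

(** On nonnegative reals the inverse is the real power of exponent -1, also at 0 where both are 0;
    real powers are measurable. *)
Lemma measurable_ge0_inv d (T : measurableType d) (R : realType) (D : set T)
    (f : T -> R) :
  measurable_fun D f -> (forall x, 0 <= f x) -> measurable_fun D (fun x => (f x)^-1).
Proof.
move=> mf f0; under eq_fun do rewrite -powR_inv1//.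
exact: (measurableT_comp (@measurable_powR R (- 1)) mf).
Qed.

(** * Folding an integral over the line onto the half-line *)

Section fold.
Context {R : realType}.
Local Notation mu := (@lebesgue_measure R).
Local Notation halfline := (@halfline R).
Implicit Types F : R -> R.

(* The junk value [fold F 0 = 0] is harmless: a point is negligible. *)
Definition fold F (t : R) : R := (F (Num.sqrt t) + F (- Num.sqrt t)) / (2 * Num.sqrt t).

Lemma measurable_halfline : measurable (halfline : set (measurableTypeR R)).
Proof. exact: measurable_itv. Qed.

Lemma halfline_ge0 (t : R) : halfline t -> 0 <= t.
Proof. by rewrite /halfline /= in_itv/= andbT. Qed.

Lemma measurable_fold F (D : set R) :
  measurable_fun [set: R] F -> measurable_fun D (fold F).
Proof.
move=> mF; have ms := @measurable_sqrt R setT.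
suff mf : measurable_fun [set: R] (fold F) by exact: measurable_funTS mf.
apply: measurable_funM.
  by apply: measurable_funD; apply: measurableT_comp => //; exact: measurableT_comp.
apply: measurable_ge0_inv; first exact: measurable_funM.
by move=> t; rewrite mulr_ge0// sqrtr_ge0.
Qed.

Lemma ge0_integral_fold F : measurable_fun [set: R] F -> (forall x, 0 <= F x) ->
  (\int[mu]_x (F x)%:E = \int[mu]_(t in halfline) (fold F t)%:E)%E.
Proof.
move=> mF F0; have ms := @measurable_sqrt R setT.
(* Chosen so that H (x |x|) times the density 2 |x| gives back F x for x nonzero. *)
pose H y := F (signed_sqrt y) / (2 * Num.sqrt `|y|).
have H0 y : 0 <= H y by rewrite /H divr_ge0// mulr_ge0// sqrtr_ge0.
have mss : measurable_fun [set: R] (@signed_sqrt R).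
  by apply: measurable_funB => //; exact: measurableT_comp.
have mH : measurable_fun [set: R] H.
  apply: measurable_funM; first exact: measurableT_comp.
  apply: measurable_ge0_inv; last by move=> t; rewrite mulr_ge0// sqrtr_ge0.
  by apply: measurable_funM => //; exact: measurableT_comp.
have mHE : measurable_fun [set: R] (EFin \o H) by exact/measurable_EFinP.
have mHN : measurable_fun [set: R] (fun y => H (- y)) by exact: measurableT_comp.
transitivity (\int[mu]_y (H y)%:E)%E.
  (* At 0 the density vanishes and the value of [F] would be lost, so this null point is removed
     from both integrals. *)
  have D1 (G : R -> \bar R) : measurable_fun [set: R] G ->
      (\int[mu]_x G x = \int[mu]_(x in [set: R] `\ 0%R) G x)%E.
    by move=> mG; rewrite integral_setD1//; [exact: measurableD|exact: measurable_funTS mG].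
  rewrite (ge0_integral_mulr_norm mHE); last by move=> y; rewrite lee_fin.
  transitivity (\int[mu]_(x in [set: R] `\ 0%R) (F x)%:E)%E.
    by apply: D1; exact/measurable_EFinP.
  apply/esym; etransitivity; first apply: D1.
    under eq_fun do rewrite -EFinM; apply/measurable_EFinP.
    apply: measurable_funM; first by apply: measurableT_comp => //; exact: measurable_mulr_norm.
    by apply: measurable_funM => //; exact: measurableT_comp.
  apply: eq_integral => x; rewrite inE => -[_ /= /eqP x0].
  rewrite -EFinM /H mulr_normK normrM normr_id -expr2 sqrtr_sqr normr_id; congr EFin.
  by rewrite divfK// mulf_neq0 ?normr_eq0.
(* The integral of [H] is cut at 0 and its negative half reflected; the two halves are the two terms
   of [fold]. *)
have -> : [set: R] = `]-oo, 0[%classic `|` halfline.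
  by rewrite /halfline -setCitvl setUv.
rewrite ge0_integral_setU//; last 4 first.
- exact: measurable_halfline.
- exact: measurable_funTS mHE.
- by move=> x _; rewrite lee_fin.
- by rewrite /halfline -setCitvl; exact/disj_setPCl.
rewrite integral_itv_bndo_bndc; last exact: measurable_funTS mHE.
have -> : (\int[mu]_(y in `]-oo, 0%R]) (H y)%:E =
    \int[mu]_(t in halfline) (H (- t))%:E)%E.
  rewrite (ge0_integration_by_substitution0 (f := fun y => (H (- y))%:E))//.
  - by apply: eq_integral => y _; rewrite opprK.
  - exact/measurable_EFinP.
  - by move=> r; rewrite lee_fin.
rewrite -ge0_integralD//; last 5 first.
- exact: measurable_halfline.
- by move=> x _; rewrite lee_fin.
- by apply/measurable_EFinP; exact: measurable_funTS mHN.
- by move=> x _; rewrite lee_fin.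
- exact: measurable_funTS mHE.
apply: eq_integral => t; rewrite inE => /halfline_ge0 t0.
rewrite /= -EFinD /H /fold /signed_sqrt normrN opprK ger0_norm//.
by rewrite (@ler0_sqrtr _ (- t)) ?oppr_le0// subr0 sub0r -mulrDl addrC.
Qed.

Lemma ge0_integrable_fold F : measurable_fun [set: R] F -> (forall x, 0 <= F x) ->
  mu.-integrable [set: R] (EFin \o F) <-> mu.-integrable halfline (EFin \o fold F).
Proof.
move=> mF F0.
have f0 t : 0 <= fold F t by rewrite divr_ge0 ?addr_ge0// mulr_ge0// sqrtr_ge0.
have E : (\int[mu]_x `|(F x)%:E| = \int[mu]_(t in halfline) `|(fold F t)%:E|)%E.
  under eq_integral do rewrite gee0_abs ?lee_fin//.
  under [RHS]eq_integral do rewrite gee0_abs ?lee_fin//.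
  exact: ge0_integral_fold.
split=> /integrableP[mf fi]; apply/integrableP; split.
- by apply/measurable_EFinP; exact: measurable_fold.
- by rewrite /= -E.
- exact/measurable_EFinP.
- by rewrite /= E.
Qed.

(** [fold] is linear, so the nonnegative case applies to the positive and negative parts [Fp] and
    [Fn], both dominated by |F|. *)
Lemma Rintegral_fold F : mu.-integrable [set: R] (EFin \o F) ->
  mu.-integrable halfline (EFin \o fold F) /\
  \int[mu]_x F x = \int[mu]_(t in halfline) fold F t.
Proof.
move=> iF; have mF : measurable_fun [set: R] F.
  by case/integrableP : iF => /measurable_EFinP.
have maF : measurable_fun [set: R] (fun x => `|F x|) by exact: measurableT_comp.
pose Fp x := (`|F x| + F x) / 2; pose Fn x := (`|F x| - F x) / 2.
have le_norm x : - `|F x| <= F x <= `|F x| by rewrite -ler_norml.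
have Fp0 x : 0 <= Fp x by have /andP[] := le_norm x; rewrite /Fp; lra.
have Fn0 x : 0 <= Fn x by have /andP[] := le_norm x; rewrite /Fn; lra.
have mFp : measurable_fun [set: R] Fp.
  by apply: measurable_funM => //; exact: measurable_funD.
have mFn : measurable_fun [set: R] Fn.
  by apply: measurable_funM => //; exact: measurable_funB.
have iFp : mu.-integrable [set: R] (EFin \o Fp).
  apply: le_integrable iF => //; first exact/measurable_EFinP.
  move=> x _ /=; rewrite lee_fin ger0_norm//.
  by have /andP[] := le_norm x; rewrite /Fp; lra.
have iFn : mu.-integrable [set: R] (EFin \o Fn).
  apply: le_integrable iF => //; first exact/measurable_EFinP.
  move=> x _ /=; rewrite lee_fin ger0_norm//.
  by have /andP[] := le_norm x; rewrite /Fn; lra.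
have ifp := (ge0_integrable_fold mFp Fp0).1 iFp.
have ifn := (ge0_integrable_fold mFn Fn0).1 iFn.
have foldE : fold F = fun t => fold Fp t - fold Fn t.
  by apply/funext => t; rewrite /fold -mulrBl; congr (_ / _); rewrite /Fp /Fn; lra.
have FE : F = fun x => Fp x - Fn x by apply/funext => x; rewrite /Fp /Fn; lra.
split.
  have iB := integrableB measurable_halfline ifp ifn.
  by rewrite foldE; apply: (eq_integrable measurable_halfline _ _ _ iB) => t _.
rewrite [in RHS]foldE [in LHS]FE !RintegralB//; try exact: measurable_halfline.
by congr (_ - _); congr fine; exact: ge0_integral_fold.
Qed.

End fold.

(** Bounds a product of even (or, after sign changes, odd) parts by the squares of the functions at
    x and -x. *)
Lemma ler_norm_half_mul (R : realFieldType) (a b c d : R) :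
  `|(a + b) / 2 * ((c + d) / 2)| <= (a ^+ 2 + c ^+ 2 + (b ^+ 2 + d ^+ 2)) / 2.
Proof.
have [h1 h2] := (sqr_ge0 (a + b - (c + d)), sqr_ge0 (a + b + (c + d))).
have [h3 h4] := (sqr_ge0 (a - b), sqr_ge0 (c - d)).
by have [_|_] := ger0P ((a + b) / 2 * ((c + d) / 2)); lra.
Qed.

(** * Square integrability and the inner product on the parabola *)

Section parabola.
Context {R : realType} (w : R -> R).
Hypotheses (w_ge0 : forall t, 0 <= t -> 0 <= w t)
  (w_meas : measurable_fun (@halfline R) w).
Local Notation mu := (@lebesgue_measure R).
Local Notation halfline := (@halfline R).
Implicit Types f g : R * R -> R.

Lemma measurable_weight : measurable_fun [set: R] (fun x : R => w (x ^+ 2)).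
Proof.
have mX : measurable_fun [set: R] (fun x : R => x ^+ 2) by exact: measurable_funX.
apply: (measurable_comp (F := halfline)) w_meas mX; first exact: measurable_itv.
by move=> _ [x _ <-]; rewrite /halfline /= in_itv/= andbT sqr_ge0.
Qed.

Lemma weight_ge0 (x : R) : 0 <= w (x ^+ 2).
Proof. by rewrite w_ge0// sqr_ge0. Qed.

(** Serves both products and sums; the factor 2 is the one in (a + b)^2 <= 2 (a^2 + b^2). *)
Lemma inL2par_dominated f g (F : R -> R) : inL2par w f -> inL2par w g ->
  measurable_fun [set: R] F ->
  (forall x, `|F x| <= 2 * ((f (x, x ^+ 2) ^+ 2 + g (x, x ^+ 2) ^+ 2) * w (x ^+ 2))) ->
  mu.-integrable [set: R] (EFin \o F).
Proof.
move=> [_ if2] [_ ig2] mF leF.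
have iD := integrableZl measurableT 2 (integrableD measurableT if2 ig2).
apply: (le_integrable measurableT _ _ iD); first exact/measurable_EFinP.
move=> x _ /=; rewrite lee_fin -mulrDl.
by apply: le_trans (ler_norm _); exact: leF.
Qed.

Lemma inL2par_mul f g : inL2par w f -> inL2par w g ->
  mu.-integrable [set: R] (EFin \o (fun x => f (x, x ^+ 2) * g (x, x ^+ 2) * w (x ^+ 2))).
Proof.
move=> Lf Lg; have [[mf _] [mg _]] := (Lf, Lg).
apply: (inL2par_dominated Lf Lg).
  by apply: measurable_funM; [exact: measurable_funM|exact: measurable_weight].
move=> x; rewrite normrM (ger0_norm (weight_ge0 x)) mulrA ler_wpM2r ?weight_ge0//.
rewrite ler_norml; apply/andP; split; nra.
Qed.

Lemma inL2parZ (c : R) f : inL2par w f -> inL2par w (fun z => c * f z).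
Proof.
move=> [mf if2]; split; first exact: measurable_funM.
have iZ := integrableZl measurableT (c ^+ 2) if2.
by apply: (eq_integrable measurableT _ _ _ iZ) => x _; rewrite -EFinM exprMn mulrA.
Qed.

Lemma inL2parD f g : inL2par w f -> inL2par w g -> inL2par w (fun z => f z + g z).
Proof.
move=> Lf Lg; have [[mf _] [mg _]] := (Lf, Lg).
have mD : measurable_fun [set: R] (fun x => f (x, x ^+ 2) + g (x, x ^+ 2)).
  exact: measurable_funD.
split=> //; apply: (inL2par_dominated Lf Lg).
  by apply: measurable_funM; [exact: measurable_funX|exact: measurable_weight].
move=> x; rewrite normrM (ger0_norm (weight_ge0 x)) mulrA ler_wpM2r ?weight_ge0//.
rewrite ger0_norm ?sqr_ge0//.
have := sqr_ge0 (f (x, x ^+ 2) - g (x, x ^+ 2)); rewrite sqrrB sqrrD; lra.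
Qed.

Lemma inL2par_sum (I : Type) (s : seq I) (F : I -> R * R -> R) :
  inL2par w (fun=> 0) -> (forall i, inL2par w (F i)) ->
  inL2par w (fun z => \sum_(i <- s) F i z).
Proof.
move=> L0 LF; elim: s => [|i s IH].
  by under eq_fun do rewrite big_nil.
by under eq_fun do rewrite big_cons; exact: inL2parD.
Qed.

(** Even and odd parts along the parabola: [ev f x] is [fe f] at x^2, and [od f x] is x times [fo f]
    at x^2. A product of two odd parts thus carries a factor t = x^2, which turns the weight [wm w]
    into [wp w]. *)
Let ev f x := (f (x, x ^+ 2) + f (- x, (- x) ^+ 2)) / 2.
Let od f x := (f (x, x ^+ 2) - f (- x, (- x) ^+ 2)) / 2.

Lemma fold_even f g t : halfline t ->
  fold (fun x => ev f x * ev g x * w (x ^+ 2)) t = fe f t * fe g t * wm w t.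
Proof.
move=> /halfline_ge0 t0; rewrite /fold /ev /fe /wm opprK !sqrrN !sqr_sqrtr//.
by rewrite invfM; move: (Num.sqrt t)^-1 => m; field.
Qed.

Lemma fold_odd f g t : halfline t ->
  fold (fun x => od f x * od g x * w (x ^+ 2)) t = fo f t * fo g t * wp w t.
Proof.
move=> /halfline_ge0 t0; rewrite /fold /od /fo /wp opprK !sqrrN !sqr_sqrtr//.
rewrite !invfM; set s := Num.sqrt t.
(* Also true at [s = 0], where the inverse is 0 by convention, so the endpoint t = 0 is covered. *)
have ss : s^-1 = s^-1 * s^-1 * s.
  have [->|s0] := eqVneq s 0; first by rewrite invr0 !mul0r.
  by rewrite mulfVK.
by rewrite [X in _ * (_ * X) = _]ss; move: s^-1 => m; field.
Qed.

Lemma pip_fold f g : inL2par w f -> inL2par w g ->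
  pip w f g = vpair (wm w) (fe f) (fe g) + vpair (wp w) (fo f) (fo g).
Proof.
move=> Lf Lg; have [[mf _] [mg _]] := (Lf, Lg).
have mN (h : R * R -> R) : measurable_fun [set: R] (fun x => h (x, x ^+ 2)) ->
    measurable_fun [set: R] (fun x => h (- x, (- x) ^+ 2)).
  move=> mh; have mopp : measurable_fun [set: R] (-%R : R -> R) by [].
  exact: (measurableT_comp mh mopp).
have mev (h : R * R -> R) : measurable_fun [set: R] (fun x => h (x, x ^+ 2)) ->
    measurable_fun [set: R] (ev h).
  by move=> mh; apply: measurable_funM => //; apply: measurable_funD => //; exact: mN.
have mod_ (h : R * R -> R) : measurable_fun [set: R] (fun x => h (x, x ^+ 2)) ->
    measurable_fun [set: R] (od h).
  by move=> mh; apply: measurable_funM => //; apply: measurable_funB => //; exact: mN.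
pose D x := (f (x, x ^+ 2) ^+ 2 + g (x, x ^+ 2) ^+ 2) * w (x ^+ 2).
have iD : mu.-integrable [set: R] (EFin \o D).
  have iD := integrableD measurableT Lf.2 Lg.2.
  by apply: (eq_integrable measurableT _ _ _ iD) => x _; rewrite /= /D mulrDl EFinD.
have [ifD _] := Rintegral_fold iD.
(* Splitting the integral requires each summand to be integrable. A bound symmetric in x and -x
   suffices, since [fold] only sees the sum of the values at the two roots. *)
have dom (G : R -> R) : measurable_fun [set: R] G ->
    (forall x, `|G x| <= (D x + D (- x)) / 2) -> mu.-integrable halfline (EFin \o fold G).
  move=> mG leG; apply: (le_integrable measurable_halfline _ _ ifD).
    by apply/measurable_EFinP; exact: measurable_fold.
  move=> t _; rewrite /= lee_fin /fold !normrM.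
  rewrite ler_wpM2r ?normr_ge0//.
  apply: le_trans (ler_norm _); apply: le_trans (ler_normD _ _) _.
  have := leG (Num.sqrt t); have := leG (- Num.sqrt t); rewrite opprK; lra.
have iev : mu.-integrable halfline (EFin \o fold (fun x => ev f x * ev g x * w (x ^+ 2))).
  apply: dom.
    by apply: measurable_funM; [apply: measurable_funM; exact: mev|exact: measurable_weight].
  move=> x; rewrite /D /ev !sqrrN -mulrDl normrM (ger0_norm (weight_ge0 x)) [leRHS]mulrAC.
  rewrite ler_wpM2r ?weight_ge0//; exact: ler_norm_half_mul.
have iod : mu.-integrable halfline (EFin \o fold (fun x => od f x * od g x * w (x ^+ 2))).
  apply: dom.
    by apply: measurable_funM; [apply: measurable_funM; exact: mod_|exact: measurable_weight].
  move=> x; rewrite /D /od !sqrrN -mulrDl normrM (ger0_norm (weight_ge0 x)) [leRHS]mulrAC.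
  (* Negating the values at -x, whose squares are unchanged, turns the odd parts into the half-sums
     of the bound. *)
  rewrite ler_wpM2r ?weight_ge0// -(sqrrN (f (- x, _))) -(sqrrN (g (- x, _))).
  exact: ler_norm_half_mul.
rewrite /pip; have [_ ->] := Rintegral_fold (inL2par_mul Lf Lg).
transitivity (\int[mu]_(t in halfline)
    (fold (fun x => ev f x * ev g x * w (x ^+ 2)) t +
     fold (fun x => od f x * od g x * w (x ^+ 2)) t)).
  (* The cross terms cancel already pointwise, between the two roots. *)
  apply: eq_Rintegral => t _; rewrite /fold -mulrDl; congr (_ / _).
  by rewrite /ev /od !opprK !sqrrN; field.
rewrite (RintegralD measurable_halfline iev iod).
by congr (_ + _); apply: eq_Rintegral => t; rewrite inE => th;
  [exact: fold_even|exact: fold_odd].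
Qed.

End parabola.

(** * Fourier coefficients, partial sums and the residual *)

Section fourier.
Context {R : realType}.
Local Notation mu := (@lebesgue_measure R).
Local Notation halfline := (@halfline R).
Implicit Types (f : R * R -> R) (v : R -> R) (p : nat -> {poly R}).

Lemma eq_vpair v g h g' h' :
  (forall t, halfline t -> g t * h t * v t = g' t * h' t * v t) ->
  vpair v g h = vpair v g' h'.
Proof. by move=> e; apply: eq_Rintegral => t; rewrite inE => /e. Qed.

Lemma vpair0 v g : vpair v g (fun=> 0) = 0.
Proof.
transitivity (\int[mu]_(t in halfline) (0 : R)).
  by apply: eq_Rintegral => t _ /=; rewrite mulr0 mul0r.
by rewrite Rintegral_cst ?mul0r//; exact: measurable_halfline.
Qed.

Lemma fe_Y1 p k : fe (Y1 p k) = fun t => (p k).[t].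
Proof. by apply/funext => t; rewrite /fe /Y1 /=; field. Qed.

Lemma fo_Y1 p k : fo (Y1 p k) = fun=> 0.
Proof. by apply/funext => t; rewrite /fo /Y1 /= subrr mul0r. Qed.

Lemma fe_Y2 p k : fe (Y2 p k) = fun=> 0.
Proof. by apply/funext => t; rewrite /fe /Y2 /= mulNr subrr mul0r. Qed.

Lemma fo_Y2 p k t : 0 < t -> fo (Y2 p k) t = (p k.-1).[t].
Proof.
move=> t0; rewrite /fo /Y2 /=; field.
by rewrite gt_eqF// sqrtr_gt0.
Qed.

(* [fo f] takes a junk value at [0], where the weight [wp w] vanishes. *)
Lemma wp0 v : wp v 0 = 0.
Proof. by rewrite /wp sqrtr0 mul0r. Qed.

Lemma eq_vpair_wp v g h g' h' :
  (forall t, 0 < t -> g t * h t = g' t * h' t) ->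
  vpair (wp v) g h = vpair (wp v) g' h'.
Proof.
move=> e; apply: eq_vpair => t /halfline_ge0; rewrite le_eqVlt => /predU1P[<-|/e->//].
by rewrite wp0 !mulr0.
Qed.

Lemma fe_fo f (x : R) : 0 < x ^+ 2 -> f (x, x ^+ 2) = fe f (x ^+ 2) + x * fo f (x ^+ 2).
Proof.
move=> x2; have x0 : x != 0 by rewrite -sqrf_eq0 gt_eqF.
rewrite /fe /fo sqrtr_sqr; have [_|_] := ger0P x; first by field.
by rewrite opprK; field.
Qed.

Section weight.
Variable w : R -> R.
Hypotheses (w_ge0 : forall t, 0 <= t -> 0 <= w t) (w_meas : measurable_fun halfline w).

(** [OPS] gives integrability on the half-line; squares being nonnegative, it transfers back to the
    line, which puts the basis functions in the space. *)
Lemma inL2par_of_fold f (F : R -> R) : measurable_fun [set: R] (fun x => f (x, x ^+ 2)) ->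
  mu.-integrable halfline (EFin \o F) ->
  (forall t, halfline t -> fold (fun x => f (x, x ^+ 2) ^+ 2 * w (x ^+ 2)) t = F t) ->
  inL2par w f.
Proof.
move=> mf iF eF; split=> //; apply/ge0_integrable_fold.
- by apply: measurable_funM; [exact: measurable_funX|exact: measurable_weight].
- by move=> x; rewrite mulr_ge0 ?sqr_ge0// weight_ge0.
apply: (eq_integrable measurable_halfline _ _ _ iF) => t; rewrite inE => th /=.
by rewrite eF.
Qed.

Lemma measurable_horner_sqr (q : {poly R}) : measurable_fun [set: R] (fun x => q.[x ^+ 2]).
Proof.
have -> : (fun x : R => q.[x ^+ 2]) = horner (q \Po 'X^2).
  by apply/funext => x; rewrite horner_comp hornerXn.
exact: measurable_poly.
Qed.

Lemma inL2par_Y1 p k : OPS (wm w) p -> inL2par w (Y1 p k).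
Proof.
case=> _ ip _ _; apply: (inL2par_of_fold _ (ip k k)); first exact: measurable_horner_sqr.
move=> t /halfline_ge0 t0; rewrite /fold /Y1 /wm /= sqrrN sqr_sqrtr//.
by rewrite invfM; move: (Num.sqrt t)^-1 => m; field.
Qed.

Lemma inL2par_Y2 p k : OPS (wp w) p -> inL2par w (Y2 p k).
Proof.
case=> _ ip _ _; apply: (inL2par_of_fold _ (ip k.-1 k.-1)).
  rewrite /Y2 /=; apply: measurable_funM => //.
  exact: (@measurable_horner_sqr (p k.-1)).
move=> t /halfline_ge0 t0; rewrite /fold /Y2 /wp /= !exprMn !sqrrN !sqr_sqrtr//.
have ts : t * (Num.sqrt t)^-1 = Num.sqrt t.
  rewrite -{1}(sqr_sqrtr t0); set s := Num.sqrt t.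
  have [->|s0] := eqVneq s 0; first by rewrite invr0 mulr0.
  by rewrite expr2 mulfK.
by rewrite -[in RHS]ts invfM; move: (Num.sqrt t)^-1 => m; field.
Qed.

Variables p1 p2 : nat -> {poly R}.
Hypotheses (Hp1 : OPS (wm w) p1) (Hp2 : OPS (wp w) p2).

Lemma pip_Y1 f k : inL2par w f ->
  pip w f (Y1 p1 k) = vpair (wm w) (fe f) (fun t => (p1 k).[t]).
Proof.
move=> Lf; rewrite (pip_fold w_ge0 w_meas Lf (inL2par_Y1 k Hp1)).
by rewrite fe_Y1 fo_Y1 vpair0 addr0.
Qed.

Lemma pip_Y2 f k : inL2par w f ->
  pip w f (Y2 p2 k) = vpair (wp w) (fo f) (fun t => (p2 k.-1).[t]).
Proof.
move=> Lf; rewrite (pip_fold w_ge0 w_meas Lf (inL2par_Y2 k Hp2)).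
by rewrite fe_Y2 vpair0 add0r; apply: eq_vpair_wp => t t0; rewrite fo_Y2.
Qed.

Lemma pip_Y1Y1 k : pip w (Y1 p1 k) (Y1 p1 k) = hk (wm w) p1 k.
Proof. by rewrite pip_Y1 ?fe_Y1//; exact: inL2par_Y1. Qed.

Lemma pip_Y2Y2 k : pip w (Y2 p2 k) (Y2 p2 k) = hk (wp w) p2 k.-1.
Proof.
rewrite pip_Y2; last exact: inL2par_Y2.
by apply: eq_vpair_wp => t t0; rewrite fo_Y2.
Qed.

Lemma pipZr (c : R) f g : inL2par w f -> inL2par w g ->
  pip w f (fun z => c * g z) = c * pip w f g.
Proof.
move=> Lf Lg; have := RintegralZl c measurableT (inL2par_mul w_ge0 w_meas Lf Lg).
by move=> <-; apply: eq_Rintegral => x _ /=; ring.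
Qed.

Lemma pipC f g : pip w f g = pip w g f.
Proof. by apply: eq_Rintegral => x _; rewrite mulrAC mulrC mulrA. Qed.

(* The constant [1] is a nonzero multiple of [Y1 p1 0]. *)
Lemma coef_const f (y : R) : inL2par w f ->
  pip w f (fun=> 1) / pip w (fun=> 1) (fun=> 1) = ghat (wm w) p1 (fe f) 0 * (p1 0).[y].
Proof.
move=> Lf; have [sz _ _ _] := Hp1.
have /size_poly1P[c c0 p1E] : size (p1 0) == 1%N by rewrite sz.
have L0 := inL2par_Y1 0 Hp1.
have oneE : (fun=> 1) = (fun z => c^-1 * Y1 p1 0 z) :> (R * R -> R).
  by apply/funext => z; rewrite /Y1 p1E hornerC mulVf.
have L1 : inL2par w (fun=> 1) by rewrite oneE; exact: inL2parZ.
have pip1 g : inL2par w g -> pip w g (fun=> 1) = c^-1 * pip w g (Y1 p1 0).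
  by move=> Lg; rewrite oneE pipZr.
(* The numerator gains one factor [c^-1] and the denominator two; the remaining [c] is the value of
   [p1 0]. *)
rewrite !pip1// (pipC (fun=> 1)) pip1// pip_Y1Y1 pip_Y1// /ghat p1E hornerC.
set h := hk _ _ _; set a := vpair _ _ _.
have h0 : h != 0 by have [_ _ _ /(_ 0)] := Hp1; exact: lt0r_neq0.
by field; rewrite h0.
Qed.

(** Stated at every point of the plane, so that [fe] and [fo] can later be applied to [Sn]
    itself. *)
Lemma Sn_fold f n z : inL2par w f -> (1 <= n)%N ->
  Sn w p1 p2 f n z =
  spart (wm w) p1 (fe f) n z.2 + z.1 * spart (wp w) p2 (fo f) n.-1 z.2.
Proof.
move=> Lf n1; rewrite /Sn (coef_const z.2 Lf) /spart.
rewrite -(big_mkord xpredT (fun k => ghat (wm w) p1 (fe f) k * (p1 k).[z.2])).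
rewrite -(big_mkord xpredT (fun k => ghat (wp w) p2 (fo f) k * (p2 k).[z.2])).
(* The constant term of [Sn] is the term k = 0 of the even partial sum. *)
rewrite big_ltn// -addrA; congr (_ + _).
rewrite (prednK n1) big_split/=; congr (_ + _).
  by apply: eq_bigr => k _; rewrite pip_Y1// pip_Y1Y1 /ghat [_^-1 * _]mulrC.
(* [Y2 p2 k] carries degree k - 1, so k = 1, ..., n becomes 0, ..., n - 1. *)
rewrite big_add1/= mulr_sumr; apply: eq_bigr => k _.
by rewrite pip_Y2// pip_Y2Y2 /ghat [_^-1 * _]mulrC mulrCA.
Qed.

Lemma inL2par_Sn f n : inL2par w f -> (1 <= n)%N -> inL2par w (Sn w p1 p2 f n).
Proof.
move=> Lf n1.
have L0 : inL2par w (fun=> 0).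
  have := inL2parZ 0 (inL2par_Y1 0 Hp1).
  by congr inL2par; apply/funext => z; rewrite mul0r.
have -> : Sn w p1 p2 f n = fun z =>
    \sum_(k < n.+1) ghat (wm w) p1 (fe f) k * Y1 p1 k z +
    \sum_(k < n.-1.+1) ghat (wp w) p2 (fo f) k * Y2 p2 k.+1 z.
  apply/funext => z; rewrite Sn_fold// /spart mulr_sumr.
  by congr (_ + _); apply: eq_bigr => k _; rewrite mulrCA.
apply: inL2parD => //; apply: inL2par_sum => // k; apply: inL2parZ.
  exact: inL2par_Y1.
exact: inL2par_Y2.
Qed.

(** By [Sn_fold] and linearity, [fe] and [fo] send the residual to the residuals of the two
    one-variable expansions; [pip_fold] then splits the square norm. For [fo] this is checked at t >
    0, the weight [wp w] vanishing at 0. *)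
Lemma pip_residual f n : inL2par w f -> (1 <= n)%N ->
  pip w (fun z => f z - Sn w p1 p2 f n z) (fun z => f z - Sn w p1 p2 f n z) =
  vnorm2 (wm w) (fun y => spart (wm w) p1 (fe f) n y - fe f y) +
  vnorm2 (wp w) (fun y => spart (wp w) p2 (fo f) n.-1 y - fo f y).
Proof.
move=> Lf n1; set g := fun z => _ - _.
have Lg : inL2par w g.
  have := inL2parD w_ge0 w_meas Lf (inL2parZ (- 1) (inL2par_Sn Lf n1)).
  by congr inL2par; apply/funext => z; rewrite mulN1r.
rewrite (pip_fold w_ge0 w_meas Lg Lg); congr (_ + _).
  apply: eq_Rintegral => t _.
  have -> : fe g t = fe f t - spart (wm w) p1 (fe f) n t.
    by rewrite /g {1}/fe !Sn_fold//= /fe; field.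
  by ring.
transitivity (vpair (wp w) (fun y => spart (wp w) p2 (fo f) n.-1 y - fo f y)
    (fun y => spart (wp w) p2 (fo f) n.-1 y - fo f y)).
  apply: eq_vpair_wp => t t0.
  have -> : fo g t = fo f t - spart (wp w) p2 (fo f) n.-1 t.
    have st0 : Num.sqrt t != 0 by rewrite gt_eqF// sqrtr_gt0.
    by rewrite /g {1}/fo !Sn_fold//= [in RHS]/fo; field.
  by ring.
by apply: eq_Rintegral => t _; rewrite expr2.
Qed.

End weight.
End fourier.

(** * The expansion, its pointwise convergence and the norm identity *)

Theorem theorem4p4 (R : realType) (w : R -> R)
  (w_ge0 : forall t : R, 0 <= t -> 0 <= w t)
  (w_meas : measurable_fun (@halfline R) w)
  (p1 p2 : nat -> {poly R})
  (Hp1 : OPS (wm w) p1) (Hp2 : OPS (wp w) p2)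
  (f : R * R -> R) (Hf : inL2par w f) :
  [/\ (forall (n : nat) (x : R), (1 <= n)%N ->
         Sn w p1 p2 f n (x, x ^+ 2) =
         spart (wm w) p1 (fe f) n (x ^+ 2) + x * spart (wp w) p2 (fo f) n.-1 (x ^+ 2)),
      (forall x : R, 0 < x ^+ 2 ->
         (fun n => spart (wm w) p1 (fe f) n (x ^+ 2)) @ \oo --> fe f (x ^+ 2) ->
         (fun n => spart (wp w) p2 (fo f) n.-1 (x ^+ 2)) @ \oo --> fo f (x ^+ 2) ->
         (fun n => Sn w p1 p2 f n (x, x ^+ 2)) @ \oo --> f (x, x ^+ 2))
    & (forall n : nat, (1 <= n)%N ->
         pip w (fun z => f z - Sn w p1 p2 f n z) (fun z => f z - Sn w p1 p2 f n z) =
         vnorm2 (wm w) (fun y => spart (wm w) p1 (fe f) n y - fe f y) +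
         vnorm2 (wp w) (fun y => spart (wp w) p2 (fo f) n.-1 y - fo f y))].
Proof.
split.
- by move=> n x n1; rewrite (Sn_fold w_ge0 w_meas Hp1 Hp2 _ Hf n1).
- move=> x x2 cve cvo; rewrite (fe_fo f x2).
  have cv : (fun n => spart (wm w) p1 (fe f) n (x ^+ 2) +
      x * spart (wp w) p2 (fo f) n.-1 (x ^+ 2)) @ \oo -->
      fe f (x ^+ 2) + x * fo f (x ^+ 2).
    by apply: cvgD => //; apply: cvgM => //; exact: cvg_cst.
  (* The expansion is available for n >= 1 only, hence eventual equality of the sequences. *)
  apply: cvg_trans cv; apply: near_eq_cvg.
  near=> n; rewrite (Sn_fold w_ge0 w_meas Hp1 Hp2)//.
  by near: n; exact: nbhs_infty_ge.
- by move=> n; exact: pip_residual.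
Unshelve. all: by end_near.
Qed.
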